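(* Let $n\geqslant 4$ and let $\iota:S_n\to S_n$ be an involution such that $\mathrm{maj}=\ell\circ\iota$ on $S_n$ (such an involution is known to exist). Then there exists an involution $\tilde\iota:S_n^D\to S_n^D$ such that $\mathrm{dmaj}=\ell_D\circ\tilde\iota$, and this involution satisfies $\tilde\iota(\sigma)=P^J(\sigma)\,\iota(\sigma_J)$ for all $\sigma\in S_n^D$.
   Context: For a sequence $\sigma=(\sigma(1),\dots,\sigma(n))$ of integers, $\mathrm{maj}(\sigma)=\sum_{i\in[n-1],\,\sigma(i)>\sigma(i+1)}i$ and $\mathrm{Neg}(\sigma)=\{i\in[n]:\sigma(i)<0\}$. $S_n^D$ is the group of bijections $w$ of $[\pm n]=\{-n,\dots,-1,1,\dots,n\}$ with $w(-a)=-w(a)$ and $|\mathrm{Neg}(w)|$ even, written as sequences $(w(1),\dots,w(n))$; it is a Coxeter group with generators $s_0=(-2,-1,3,\dots,n)$ and $s_i=(1,\dots,i-1,i+1,i,i+2,\dots,n)$ for $1\le i\le n-1$, with length $\ell_D$. Let $J=\{s_1,\dots,s_{n-1}\}$; $S_n$ is identified with the parabolic subgroup generated by $J$, and $\ell$ is the Coxeter length of $S_n$ (number of inversions). Each $\sigma\in S_n^D$ factors uniquely as $\sigma=\sigma^J\sigma_J$ with $\sigma_J\in S_n$, $\sigma^J\in\{w:\ell_D(ws)>\ell_D(w)\ \forall s\in J\}$ and $\ell_D(\sigma)=\ell_D(\sigma^J)+\ell_D(\sigma_J)$; $P^J(\sigma):=\sigma^J$. The D-negative major index is $\mathrm{dmaj}(\sigma)=\mathrm{maj}(\sigma)-\sum_{i\in\mathrm{Neg}(\sigma)}\sigma(i)-|\mathrm{Neg}(\sigma)|$.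 An involution is a map of sets whose square is the identity. *)

(* Defs.v *)
From HB Require Import structures.
From mathcomp Require Import all_boot all_order all_algebra all_fingroup.

Set Implicit Arguments.
Unset Strict Implicit.
Unset Printing Implicit Defensive.

Import Order.TTheory GRing.Theory Num.Theory.
Local Open Scope ring_scope.

(* s = (s(1), ..., s(n)) is indexed from 0 by nth and tnth, so the position i
   of the mathematics is the index i - 1; maj sums the 1-based positions. *)
Definition maj (n : nat) (s : n.-tuple int) : nat :=
  (\sum_(1 <= i < n | (s`_i.-1 > s`_i)%R) i)%N.

Definition Neg (n : nat) (s : n.-tuple int) : {set 'I_n} :=
  [set i | tnth s i < 0].

Definition dmaj (n : nat) (s : n.-tuple int) : int :=
  (maj s)%:Z - \sum_(i in Neg s) tnth s i - #|Neg s|%:Z.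

(* The product of {perm T} is diagrammatic, (v * u) x = u (v x), whereas
   permutations are composed here as functions: (uv)(x) = u(v(x)). *)
Definition fcomp (T : finType) (u v : {perm T}) : {perm T} := (v * u)%g.

Lemma fcompE (T : finType) (u v : {perm T}) (x : T) : fcomp u v x = u (v x).
Proof. exact: permM. Qed.

(* Least number of factors in an expression of w as a product of elements of S
   (S ^+ k is the set of products of k elements of S). The prefixes of a
   shortest word are pairwise distinct, so for w in <<S>> that number is always
   less than #|gT|; for other w the value is the meaningless #|gT|. *)
Definition wlen (gT : finGroupType) (S : {set gT}) (w : gT) : nat :=
  find (fun k => w \in (S ^+ k)%g) (iota 0 #|gT|).

(* [+-n] = {-n, ..., -1, 1, ..., n}: (i, b) stands for (-1)^b (i + 1). *)
Definition pm (n : nat) : finType := ('I_n * bool)%type.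

Definition pmval (n : nat) (a : pm n) : int := (-1) ^+ a.2 * (a.1.+1)%:Z.

Definition pmopp (n : nat) (a : pm n) : pm n := (a.1, ~~ a.2).

Lemma pmval_opp (n : nat) (a : pm n) : pmval (pmopp a) = - pmval a.
Proof. by case: a => i []; rewrite /pmval /= expr0 expr1 mulN1r mul1r ?opprK. Qed.

Definition pword (n : nat) (w : {perm pm n}) : n.-tuple int :=
  [tuple pmval (w (i, false)) | i < n].

Definition SD (n : nat) : {set {perm pm n}} :=
  [set w : {perm pm n} | [forall a, w (pmopp a) == pmopp (w a)]
                         && ~~ odd #|Neg (pword w)|].

Definition SDtype (n : nat) : finType := {w : {perm pm n} | w \in SD n}.

Definition sword (n : nat) (u : 'S_n) : n.-tuple int :=
  [tuple ((u i).+1)%:Z | i < n].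

Definition emb_fun (n : nat) (u : 'S_n) (a : pm n) : pm n := (u a.1, a.2).

Lemma emb_inj (n : nat) (u : 'S_n) : injective (emb_fun u).
Proof. by move=> [i b] [j c] [] /perm_inj -> ->. Qed.

Definition emb (n : nat) (u : 'S_n) : {perm pm n} := perm (@emb_inj n u).

Definition Sgen (n : nat) : {set 'S_n} :=
  [set tperm i j | i in 'I_n, j in 'I_n & nat_of_ord j == i.+1].

Definition ell (n : nat) (u : 'S_n) : nat := wlen (Sgen n) u.

Definition J (n : nat) : {set {perm pm n}} := @emb n @: Sgen n.

(* The only element is s_0 = (-2, -1, 3, ..., n), which exchanges 1 with -2 and
   -1 with 2. It is written as a set since 'I_n has elements 0 and 1 only
   for n >= 2. *)
Definition S0 (n : nat) : {set {perm pm n}} :=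
  [set (tperm ((i, false) : pm n) (j, true)
        * tperm ((i, true) : pm n) (j, false))%g
     | i in 'I_n, j in 'I_n & (nat_of_ord i == 0%N) && (nat_of_ord j == 1%N)].

Definition ellD (n : nat) (w : {perm pm n}) : nat := wlen (S0 n :|: J n) w.

Definition minrepJ (n : nat) : {set {perm pm n}} :=
  [set w : {perm pm n} in SD n | [forall s in J n, (ellD (fcomp w s) > ellD w)%N]].

Definition factJ (n : nat) (w : {perm pm n}) (p : {perm pm n} * 'S_n) : bool :=
  [&& p.1 \in minrepJ n, w == fcomp p.1 (emb p.2)
    & ellD w == (ellD p.1 + ellD (emb p.2))%N].

(* If 2 <= n and w is in SD n, exactly one pair satisfies factJ w, so the default value is
   not used. *)
Definition factorJ (n : nat) (w : {perm pm n}) : {perm pm n} * 'S_n :=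
  odflt (1%g, 1%g) [pick p | factJ w p].

Definition PJ (n : nat) (w : {perm pm n}) : {perm pm n} := (factorJ w).1.

Definition partJ (n : nat) (w : {perm pm n}) : 'S_n := (factorJ w).2.

(* Main.v *)
Require Import Defs.
From HB Require Import structures.
From mathcomp Require Import all_boot all_order all_algebra all_fingroup.
From mathcomp Require Import zify.

(** The Coxeter length of type D splits as ell_D(w) = inv(w) + N(w), where
    inv(w) counts the inversions of the word of w and N(w) is the sum of
    |w(i)| - 1 over the positions i with w(i) < 0. Since N depends only on the
    set of values of w, it is unchanged when w is multiplied on the right by
    a permutation of positions; and dmaj = maj + N straight from its
    definition. Thus dmaj and ell_D differ exactly as maj and inv do.

    An element lies in the set of minimal representatives if and only if its
    word is increasing, so that the factorization of w is the sorting of its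
    word: the first factor p is the increasing rearrangement, the second
    factor u is the standardization. Then inv(w) = inv(u) = ell(u) and
    maj(w) = maj(u), whence
      dmaj(w) = maj(u) + N(p) = ell(iota(u)) + N(p) = ell_D(p iota(u)).
    The map sending p u to p iota(u) keeps the first factor and applies iota
    to the second one, hence it is an involution (factorJ_eq, SD_factor).

    The length formulas rest on two facts. A function that vanishes at the
    identity only, grows by at most 1 under multiplication by a generator and
    can always be lowered by some generator is the word length (wlen_eq).
    Inversions are counted as positive roots made negative by w: a simple
    reflection permutes the positive roots outside the set A of those that it
    makes negative, so that multiplication by it only changes the contribution
    of A (invs_mul). In type A a root is an ordered pair of positions. In type
    D it is a pair a < b in [+-n] with |a| <> |b|, where (a, b) and (-b, -a)
    name the same root, so that the count over pairs is 2 ell_D.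

    As products in {perm T} are diagrammatic, the right multiplication of w by
    s in the sense of functions is written s * w; it acts on positions. *)

Set Implicit Arguments.
Unset Strict Implicit.
Unset Printing Implicit Defensive.

Import Order.TTheory GRing.Theory Num.Theory.

(** * Word length *)

(** Induction on word length bounds f w from above by the length, and repeated
    descents write w as a product of f w generators. The descents also make f
    take every value from 0 to f w, so the group has more than f w elements;
    this keeps f w inside the range searched by wlen. *)
Lemma wlen_eq (gT : finGroupType) (S G : {set gT}) (f : gT -> nat) :
    (1%g \in G) -> f 1%g = 0 ->
    (forall s, s \in S -> (s * s = 1)%g) ->
    (forall s w, s \in S -> w \in G -> (s * w)%g \in G) ->
    (forall s w, s \in S -> w \in G -> f (s * w)%g <= (f w).+1) ->
    (forall w, w \in G -> w != 1%g -> exists2 s, s \in S & f (s * w)%g < f w) ->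
  forall w, w \in G -> wlen S w = f w.
Proof.
move=> G1 f1 S2 SG fS descent.
have lower k w : w \in (S ^+ k)%g -> (w \in G) && (f w <= k).
  elim: k w => [|k IHk] w; first by rewrite expg0 => /set1P->; rewrite G1 f1.
  rewrite expgS => /mulsgP[s v sS vk ->]; case/andP: (IHk v vk) => vG fv.
  by rewrite SG //= (leq_trans (fS s v sS vG)).
have step w : w \in G -> w != 1%g ->
    exists s, [/\ s \in S, (s * w)%g \in G, w = (s * (s * w))%g
                & f w = (f (s * w)%g).+1].
  move=> wG /(descent w wG)[s sS flt].
  have swG := SG s w sS wG; have ww : w = (s * (s * w))%g.
    by rewrite mulgA S2 // mul1g.
  by exists s; split=> //; apply/eqP; rewrite eqn_leq flt andbT {1}ww fS.
have upper w : w \in G -> w \in (S ^+ f w)%g.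
  have [k] := ubnP (f w); elim: k w => // k IHk w ltk wG.
  have [->|w1] := eqVneq w 1%g; first by rewrite f1 expg0 set11.
  have [s [sS swG ww fw]] := step w wG w1.
  by rewrite fw expgS {1}ww mem_mulg // IHk // -ltnS -fw.
have attained w k : w \in G -> k <= f w -> exists v, f v == k.
  have [m] := ubnP (f w); elim: m w => // m IHm w ltm wG.
  rewrite leq_eqVlt => /predU1P[->|ltk]; first by exists w.
  have w1 : w != 1%g by apply/eqP=> w1; rewrite w1 f1 in ltk.
  have [s [sS swG _ fw]] := step w wG w1.
  by apply: (IHm (s * w)%g); rewrite // -ltnS -fw.
have bound w : w \in G -> f w < #|gT|.
  move=> wG; pose h (k : 'I_(f w).+1) :=
    xchoose (attained w k wG (ltn_ord k)).
  have hK k : f (h k) = k.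
    by apply/eqP; exact: (xchooseP (attained w k wG (ltn_ord k))).
  rewrite -[(f w).+1]card_ord -(card_codom (f := h)) ?max_card //.
  by move=> k l /(congr1 f); rewrite !hK => /val_inj.
move=> w wG; rewrite /wlen; have fb := bound w wG; have fu := upper w wG.
apply/eqP; rewrite eqn_leq; apply/andP; split.
  rewrite leqNgt; apply/negP=> /(before_find 0); rewrite nth_iota //= add0n.
  by rewrite fu.
have hs : has (fun k => w \in (S ^+ k)%g) (iota 0 #|gT|).
  by apply/hasP; exists (f w); rewrite // mem_iota add0n.
have := nth_find 0 hs; rewrite nth_iota ?add0n; last first.
  by move: hs; rewrite has_find size_iota.
by case/lower/andP.
Qed.

(** * Counting inversions as roots *)

(** A pair (x.1, x.2) with P x.1 x.2 stands for a positive root, and the swapped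
    pair for its opposite. *)
Definition invs (T : finType) (P : rel T) (w : {perm T}) : nat :=
  \sum_(x : T * T | P x.1 x.2) P (w x.2) (w x.1).

(** The positive roots outside A are permuted by s, and their terms in the two
    counts correspond. On A, s followed by swapping the entries is a
    permutation, so a root of A counts for s * w when w keeps it positive and
    for w when w makes it negative. *)
Lemma invs_mul (T : finType) (P : rel T) (s w : {perm T}) (A : {set T * T}) :
    (forall a b, P a b -> ~~ P b a) ->
    (forall a b, P (s a) (s b) || P (s b) (s a) = P a b || P b a) ->
    involutive s ->
    (forall a b, ((a, b) \in A) = P a b && P (s b) (s a)) ->
  invs P (s * w) + \sum_(x in A) P (w x.2) (w x.1)
    = invs P w + \sum_(x in A) P (w x.1) (w x.2).
Proof.
move=> Pasym Ps sK AP.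
have splitA (F : T * T -> nat) : \sum_(x | P x.1 x.2) F x
    = \sum_(x in A) F x + \sum_(x | P x.1 x.2 && (x \notin A)) F x.
  rewrite (bigID (mem A)) /=; congr (_ + _); apply: eq_bigl => -[a b] /=.
  by apply: andb_idl; rewrite AP => /andP[].
rewrite /invs !splitA.
(* Reindex A by s followed by the swap, and its complement by s alone. *)
rewrite [X in X + _ + _ = _](reindex_inj (h := fun x => (s x.2, s x.1)));
  last first.
  by move=> [a b] [c d] [] /perm_inj-> /perm_inj->.
rewrite [X in _ + X + _ = _](reindex_inj (h := fun x => (s x.1, s x.2))) /=;
  last first.
  by move=> [a b] [c d] [] /perm_inj-> /perm_inj->.
rewrite addnC addnA [RHS]addnAC; congr (_ + _ + _).
- apply: eq_big => [[a b]|[a b] _] /=; last by rewrite !permM !sK.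
  by rewrite !AP !sK andbC.
apply: eq_big => [[a b]|[a b] _] /=; last by rewrite !permM !sK.
rewrite !AP !sK; have := Ps a b; have := Pasym a b; have := Pasym (s a) (s b).
case: (P a b) (P b a) (P (s a) (s b)) (P (s b) (s a)) => -[] [] [] //=.
all: by move=> // /(_ isT).
Qed.

(** * Permutations of positions *)

Lemma val_tperm n (i j k : 'I_n) :
  val (tperm i j k) = if val k == val i then val j else
                      if val k == val j then val i else val k.
Proof.
rewrite !val_eqE; case: tpermP => [->|->|/eqP/negPf-> /eqP/negPf->];
  rewrite ?eqxx //.
by case: eqP => // ->.
Qed.

Definition ltI n : rel 'I_n := fun i j => i < j.

Lemma tperm_succ_inv n (i j : 'I_n) : val j = (val i).+1 ->
  forall k l, ltI k l && ltI (tperm i j l) (tperm i j k) = (k == i) && (l == j).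
Proof.
move=> ij k l; rewrite /ltI -!val_eqE !val_tperm ij /=.
move: (nat_of_ord i) (nat_of_ord k) (nat_of_ord l) => {ij j}i {}k {}l.
by do !case: eqP => //=; lia.
Qed.

Lemma invs_succ n (i j : 'I_n) (u : 'S_n) : val j = (val i).+1 ->
  invs (@ltI n) (tperm i j * u) + (u j < u i) = invs (@ltI n) u + (u i < u j).
Proof.
move=> ij; have /= := @invs_mul _ (@ltI n) (tperm i j) u [set (i, j)].
rewrite !big_set1 /=; apply.
- by move=> a b; rewrite /ltI; lia.
- move=> a b; rewrite /ltI -!neq_ltn !(inj_eq val_inj).
  by rewrite (inj_eq perm_inj).
- exact: tpermK.
by move=> a b; rewrite tperm_succ_inv // inE xpair_eqE.
Qed.

(** Used to read f off the order of its values: f i is the number of values of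
    f below f i. *)
Lemma count_lt n (f : 'I_n -> 'I_n) (k : nat) : injective f -> k <= n ->
  \sum_j (f j < k) = k.
Proof.
move=> finj kn; pose F (j : 'I_n) : nat := j < k.
have /= <- := reindex_inj (P := xpredT) (F := F) finj.
rewrite -big_mkcond /= -(big_ord_widen n (fun _ => 1)) //.
by rewrite sum1_card card_ord.
Qed.

Lemma perm_rank n (u : 'S_n) (v : 'I_n -> int) (i : 'I_n) :
    (forall j k, ((v j < v k)%R = (u j < u k))) ->
  val (u i) = \sum_j (v j < v i)%R.
Proof.
move=> vu; rewrite -[LHS](count_lt (@perm_inj _ u)) ?(ltnW (ltn_ord _)) //.
by apply: eq_bigr => j _; rewrite vu.
Qed.

(** The standardization of v: the rank of v i is the number of values of v
    below v i. *)
Lemma rank_exists n (v : 'I_n -> int) : injective v ->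
  exists u : 'S_n, forall i j, (u i < u j) = (v i < v j)%R.
Proof.
move=> vinj; pose below i := [set j | (v j < v i)%R].
have bmono i j : (v i < v j)%R -> #|below i| < #|below j|.
  move=> ltij; apply: proper_card; apply/properP; split.
    by apply/subsetP=> k; rewrite !inE => /lt_trans; apply.
  by exists i; rewrite !inE ?ltxx.
have bn i : #|below i| < n.
  rewrite -[n in _ < n]card_ord -cardsT; apply: proper_card.
  by rewrite properT; apply/eqP=> /setP/(_ i); rewrite !inE ltxx.
have binj : injective (fun i => Ordinal (bn i)).
  move=> i j [] e; apply: vinj; apply/eqP; apply/negPn; rewrite neq_lt.
  by apply/negP=> /orP[] /bmono; rewrite e ltnn.
exists (perm binj) => i j; rewrite !permE /=.
apply/idP/idP=> [|/bmono//]; apply: contraTT; rewrite -leNgt -leqNgt.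
by rewrite le_eqVlt => /predU1P[/vinj->//|/bmono/ltnW].
Qed.

Lemma succ_incr n (v : 'I_n -> int) :
    (forall i j : 'I_n, val j = (val i).+1 -> (v i < v j)%R) ->
  forall i j, (v i < v j)%R = (i < j).
Proof.
move=> vS; have lt (i j : 'I_n) : i < j -> (v i < v j)%R.
  case: j => j; elim: j => // j IHj jn /=; rewrite ltnS => lij.
  have jn' : j < n by apply: ltnW.
  have vj : (v (Ordinal jn') < v (Ordinal jn))%R by apply: vS.
  move: lij; rewrite leq_eqVlt => /predU1P[e|/(IHj jn')/lt_trans]; last exact.
  by rewrite (_ : i = Ordinal jn') //; apply: val_inj.
move=> i j; apply/idP/idP=> [|/lt//]; apply: contraTT; rewrite -leqNgt -leNgt.
by rewrite leq_eqVlt => /predU1P[/val_inj->//|/lt/ltW].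
Qed.

Lemma descent_or_increasing n (v : 'I_n -> int) : injective v ->
  (exists i j : 'I_n, val j = (val i).+1 /\ (v j < v i)%R)
    \/ (forall i j, (v i < v j)%R = (i < j)).
Proof.
move=> vinj.
have [/existsP[i /existsP[j /andP[/eqP ij lt]]]|no] := boolP
    [exists i : 'I_n, exists j : 'I_n, (val j == (val i).+1) && (v j < v i)%R].
  by left; exists i, j.
right; apply: succ_incr => i j ij.
have neq : v i != v j by rewrite (inj_eq vinj) -val_eqE /= ij ltn_eqF.
rewrite lt_neqAle neq leNgt; apply: contra no => lt; apply/existsP; exists i.
by apply/existsP; exists j; rewrite ij eqxx.
Qed.

Lemma increasing_perm1 n (u : 'S_n) :
  (forall i j : 'I_n, (u i < u j) = (i < j)) -> u = 1%g.
Proof.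
move=> uincr; apply/permP=> i; rewrite perm1; apply: val_inj.
rewrite -[LHS](count_lt (@perm_inj _ u)) ?(ltnW (ltn_ord _)) //.
rewrite -[RHS](@count_lt n id) ?(ltnW (ltn_ord _)) //.
by apply: eq_bigr => j _; rewrite uincr.
Qed.

(** The shape a + x = b + y is that in which the reflection lemmas express that
    a length changes by 1, with x and y telling a descent from an ascent. *)
Lemma eq_add_bool_le (a b : nat) (x y : bool) : a + x = b + y -> a <= b.+1.
Proof. by case: x y => -[]; rewrite ?addn0 ?addn1; lia. Qed.

Lemma eq_add_bool_lt (a b : nat) (x y : bool) :
  a + x = b + y -> x -> ~~ y -> a < b.
Proof. by case: x y => -[]; rewrite ?addn0 ?addn1 => // ->. Qed.

(** * The length of the symmetric group *)

Lemma ellE n (u : 'S_n) : ell u = invs (@ltI n) u.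
Proof.
rewrite /ell; apply: (@wlen_eq _ _ setT) => //.
- rewrite /invs big1 // => -[i j]; rewrite /ltI /= !perm1 => ij.
  by rewrite ltnNge ltnW.
- by move=> s /imset2P[i j _ _ ->]; rewrite tperm2.
- by move=> *; rewrite inE.
- move=> s w /imset2P[i j _]; rewrite inE => /eqP ij -> _.
  exact: eq_add_bool_le (invs_succ w ij).
have vinj (w : 'S_n) : injective (fun i => Posz (w i)).
  by move=> i j /= [e]; apply/(@perm_inj _ w)/val_inj.
move=> w _ w1; have [[i [j [ij lt]]]|incr] := descent_or_increasing (vinj w).
  exists (tperm i j).
    by apply/imset2P; exists i j; rewrite // inE; apply/eqP.
  rewrite ltz_nat in lt.
  by apply: (eq_add_bool_lt (invs_succ w ij) lt); rewrite -leqNgt ltnW.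
by case/eqP: w1; apply: increasing_perm1 => i j; rewrite -[RHS]incr.
Qed.

(** * Signed permutations and the roots of type D *)

Lemma pmvalE n (a : pm n) :
  pmval a = if a.2 then (- Posz a.1.+1)%R else Posz a.1.+1.
Proof. by case: a => i []; rewrite /pmval /= ?expr0 ?expr1 ?mulN1r ?mul1r. Qed.

Lemma pmval_inj n : injective (@pmval n).
Proof.
move=> [i c] [j d]; rewrite !pmvalE /= => e.
have ij : val i = val j by move: e; case: c d => -[] /=; lia.
by rewrite (val_inj ij); congr (_, _); move: e; case: c d => -[] /=; lia.
Qed.

Lemma pmval_lt n (a b : pm n) : (pmval a < pmval b)%R =
  if a.2 then (if b.2 then b.1 < a.1 else true)
  else (if b.2 then false else a.1 < b.1).
Proof. by rewrite !pmvalE; case: a b => i [] [j []] /=; lia. Qed.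

(** The pair (a, b) stands for the root e_b - e_a, with e_(-i) = - e_i; the
    condition on first components excludes b = - a, which would give the
    roots 2 e_b of type C. *)
Definition posroot n : rel (pm n) :=
  fun a b => (pmval a < pmval b)%R && (a.1 != b.1).

Lemma posroot_asym n (a b : pm n) : posroot a b -> ~~ posroot b a.
Proof. by case/andP=> ab _; rewrite /posroot lt_gtF. Qed.

Lemma posroot_comparable n (a b : pm n) :
  posroot a b || posroot b a = (a.1 != b.1).
Proof.
rewrite /posroot eq_sym [b.1 == _]eq_sym -andb_orl -neq_lt.
rewrite (inj_eq (@pmval_inj n)).
by apply: andb_idl; apply: contraNneq => ->.
Qed.

Definition signed n (w : {perm pm n}) : Prop :=
  forall a, w (pmopp a) = pmopp (w a).

Lemma signed_true n (w : {perm pm n}) i : signed w ->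
  w (i, true) = pmopp (w (i, false)).
Proof. by move=> <-. Qed.

Lemma signed_fst n (w : {perm pm n}) a b : signed w ->
  ((w a).1 == (w b).1) = (a.1 == b.1).
Proof.
have fst_eq (x y : pm n) : (x.1 == y.1) = (x == y) || (x == pmopp y).
  case: x y => i c [j d]; rewrite /pmopp !xpair_eqE /= -andb_orr.
  by case: c d => -[]; rewrite andbT.
by move=> ws; rewrite !fst_eq -ws !(inj_eq perm_inj).
Qed.

Definition wval n (w : {perm pm n}) (i : 'I_n) : int := pmval (w (i, false)).

Definition increasing n (w : {perm pm n}) : Prop :=
  forall i j, (wval w i < wval w j)%R = (i < j).

Lemma wval_inj n (w : {perm pm n}) : injective (wval w).
Proof. by move=> i j /pmval_inj/perm_inj[]. Qed.

(** * The candidate for the length of type D *)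

Definition winv n (w : {perm pm n}) : nat :=
  \sum_(i < n) \sum_(j < n) (i < j) && (wval w j < wval w i)%R.

(** This is the sum of |w(i)| - 1 over the negative entries: the entry w(i) has
    absolute value one more than the index (w (i, false)).1. *)
Definition wneg n (w : {perm pm n}) : nat :=
  \sum_(i < n | (w (i, false)).2) (w (i, false)).1.

Definition lenD n (w : {perm pm n}) : nat := winv w + wneg w.

Lemma sum_pm n (F : pm n -> nat) :
  \sum_a F a = \sum_i (F (i, true) + F (i, false)).
Proof.
transitivity (\sum_i \sum_c F (i, c)).
  by rewrite pair_bigA; apply: eq_bigr => -[].
by apply: eq_bigr => i _; rewrite big_bool.
Qed.

(** Every absolute value smaller than |w(i)| occurs exactly once in the word. *)
Lemma wneg_count n (w : {perm pm n}) : signed w ->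
  wneg w = \sum_i \sum_j
    (w (i, false)).2 && ((w (j, false)).1 < (w (i, false)).1).
Proof.
move=> ws; rewrite /wneg big_mkcond; apply: eq_bigr => i _.
case: ifP => /= _; last by rewrite big1.
have finj : injective (fun j => (w (j, false)).1).
  by move=> j k /eqP; rewrite signed_fst // => /eqP.
by symmetry; apply: (count_lt finj); apply: ltnW.
Qed.

(** Pairs of two positive or of two negative elements both give the inversions
    of the word. A pair (-i, j) with i <> j is inverted when
    w(i) + w(j) < 0, that is, when the entry that is larger in absolute value
    is negative; summing over these entries gives N(w) twice. *)
Lemma invs_lenD n (w : {perm pm n}) :
  signed w -> invs (@posroot n) w = (lenD w).*2.
Proof.
move=> ws; pose F (a b : pm n) : nat := posroot a b && posroot (w b) (w a).
pose I (i j : 'I_n) : nat := (i < j) && (wval w j < wval w i)%R.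
pose M (i j : 'I_n) : nat :=
  (w (i, false)).2 && ((w (j, false)).1 < (w (i, false)).1).
(* I counts inversions, M the negative entries together with the smaller
   absolute values. The identity holds for i = j too, as both sides vanish. *)
have FE (i j : 'I_n) : F (i, true) (j, true) + F (i, true) (j, false)
    + (F (i, false) (j, true) + F (i, false) (j, false))
    = I i j + M i j + (I j i + M j i).
  rewrite /F /I /M /posroot /wval !signed_fst //= !signed_true //.
  have := signed_fst (i, false) (j, false) ws => /=.
  case: (w (i, false)) (w (j, false)) => k c [l d] /=.
  rewrite !pmval_lt /= -!val_eqE /=.
  move: (nat_of_ord i) (nat_of_ord j) (nat_of_ord k) (nat_of_ord l).
  move=> {}i {}j {}k {}l.
  by case: c; case: d => /=; case: (ltngtP i j) => //= _; case: (ltngtP k l).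
rewrite /invs big_mkcond /= (eq_bigr (fun x => F x.1 x.2)); last first.
  by move=> [a b] _; rewrite /F; case: ifP.
rewrite -(pair_bigA _ F) /= sum_pm /=.
under eq_bigr => i _.
  rewrite !sum_pm -big_split /=; under eq_bigr => j _ do rewrite FE.
  rewrite !big_split; over.
rewrite /= !big_split /= [X in _ + _ + (X + _)]exchange_big.
rewrite [X in _ + _ + (_ + X)]exchange_big addnn.
by rewrite /lenD wneg_count.
Qed.

(** The two pairs (a, b) and (-b, -a) are the same root and change together, so
    the change by 2 in the count of pairs is a change by 1 in lenD. *)
Lemma lenD_reflection n (s w : {perm pm n}) (a b : pm n) :
    signed s -> signed w -> involutive s -> a.1 != b.1 ->
    (forall c d, posroot c d && posroot (s d) (s c)
       = ((c, d) == (a, b)) || ((c, d) == (pmopp b, pmopp a))) ->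
  lenD (s * w) + (pmval (w b) < pmval (w a))%R
    = lenD w + (pmval (w a) < pmval (w b))%R.
Proof.
move=> ss ws sK ab As.
have sws : signed (s * w) by move=> c; rewrite !permM ss ws.
have sP c d : posroot (s c) (s d) || posroot (s d) (s c)
    = posroot c d || posroot d c.
  by rewrite !posroot_comparable signed_fst.
have sA c d : ((c, d) \in [set (a, b); (pmopp b, pmopp a)])
    = posroot c d && posroot (s d) (s c).
  by rewrite As !inE.
have := invs_mul w (@posroot_asym n) sP sK sA; rewrite !invs_lenD //.
rewrite !big_setU1 ?big_set1 /= ?inE; last 2 first.
- by apply: contraNneq ab => -[-> _].
- by apply: contraNneq ab => -[-> _].
rewrite /posroot !signed_fst //= ![b.1 == _]eq_sym ab !andbT.
rewrite !ws !pmval_opp !ltrN2.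
by move: (nat_of_bool _) (nat_of_bool _) => x y; lia.
Qed.

Lemma embE n (u : 'S_n) i c : emb u (i, c) = (u i, c).
Proof. by rewrite permE. Qed.

Lemma signed_emb n (u : 'S_n) : signed (emb u).
Proof. by move=> a; rewrite !permE. Qed.

Lemma signed_mul n (v w : {perm pm n}) :
  signed v -> signed w -> signed (v * w).
Proof. by move=> vs ws a; rewrite !permM vs ws. Qed.

(** * The action of the generators *)

Lemma lenD_J n (i j : 'I_n) (w : {perm pm n}) :
    signed w -> val j = (val i).+1 ->
  lenD (emb (tperm i j) * w) + (wval w j < wval w i)%R
    = lenD w + (wval w i < wval w j)%R.
Proof.
move=> ws ij; apply: (@lenD_reflection _ _ _ (i, false) (j, false)) => //.
- exact: signed_emb.
- by move=> [k c]; rewrite !embE tpermK.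
- by rewrite -val_eqE /= ij neq_ltn ltnSn.
move=> [k c] [l d]; rewrite !embE /posroot !pmval_lt !xpair_eqE /=.
rewrite (inj_eq perm_inj) -!val_eqE !val_tperm ij /=.
move: (nat_of_ord i) (nat_of_ord k) (nat_of_ord l) => {ij j}i {}k {}l.
by case: c; case: d => /=; do !case: eqP => //=; lia.
Qed.

Definition sgen0 n (i j : 'I_n) : {perm pm n} :=
  (tperm (i, false) (j, true) * tperm (i, true) (j, false))%g.

(** s_0 exchanges the two positions and changes the sign of both entries. *)
Lemma sgen0E n (i j k : 'I_n) c : i != j ->
  sgen0 i j (k, c) = (tperm i j k, c (+) ((k == i) || (k == j))).
Proof.
move=> ij; rewrite permM.
have [->|ki] := eqVneq k i.
  rewrite tpermL addbT; case: c.
    rewrite (tpermD (x := (i, false))) ?tpermL // xpair_eqE ?andbF //.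
    by rewrite (eq_sym j) (negPf ij).
  by rewrite tpermL tpermD // xpair_eqE ?andbF // (negPf ij).
have [->|kj] := eqVneq k j.
  rewrite tpermR addbT; case: c.
    by rewrite tpermR tpermD // xpair_eqE ?andbF // eq_sym (negPf ij).
  rewrite (tpermD (x := (i, false))) ?tpermR // xpair_eqE ?andbF //.
  by rewrite (negPf ij).
by rewrite addbF !tpermD ?xpair_eqE ?[_ == k]eq_sym ?(negPf ki) ?(negPf kj).
Qed.

Lemma signed_sgen0 n (i j : 'I_n) : i != j -> signed (sgen0 i j).
Proof. by move=> ij [k c]; rewrite !sgen0E // /pmopp /= addNb. Qed.

Lemma sgen0K n (i j : 'I_n) : i != j -> involutive (sgen0 i j).
Proof.
move=> ij [k c]; rewrite !sgen0E // tpermK; congr (_, _).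
rewrite -addbA; case: tpermP => [->|->|/eqP/negPf-> /eqP/negPf->];
  by rewrite ?eqxx ?orbT ?addbF ?addbb ?addbF.
Qed.

(** The root made negative by s_0 is the pair (-1, 2), whose image under w is
    (-w(1), w(2)). *)
Lemma lenD_S0 n (i j : 'I_n) (w : {perm pm n}) :
    signed w -> val i = 0 -> val j = 1 ->
  lenD (sgen0 i j * w) + (wval w i + wval w j < 0)%R
    = lenD w + (0 < wval w i + wval w j)%R.
Proof.
move=> ws i0 j1; have ij : i != j by rewrite -val_eqE /= i0 j1.
have -> : (wval w i + wval w j < 0)%R
    = (pmval (w (j, false)) < pmval (w (i, true)))%R.
  rewrite signed_true // pmval_opp -!/(wval _ _).
  by move: (wval w i) (wval w j) => x y; lia.
have -> : (0 < wval w i + wval w j)%R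
    = (pmval (w (i, true)) < pmval (w (j, false)))%R.
  rewrite signed_true // pmval_opp -!/(wval _ _).
  by move: (wval w i) (wval w j) => x y; lia.
apply: lenD_reflection => //.
- exact: signed_sgen0.
- exact: sgen0K.
move=> [k c] [l d]; rewrite !sgen0E // /posroot !pmval_lt !xpair_eqE /=.
rewrite (inj_eq perm_inj) -!val_eqE !val_tperm i0 j1 /=.
move: (nat_of_ord k) (nat_of_ord l) => {}k {}l.
by case: c; case: d => /=; case: k => [|[|k]]; case: l => [|[|l]] //=; lia.
Qed.

(** * The group of type D and its length *)

(** The parity of the number of negative entries, as a sum modulo 2, which can
    be split and reindexed. *)
Definition signpar n (w : {perm pm n}) : bool :=
  \big[addb/false]_(i < n) (w (i, false)).2.

Lemma mem_SD n (w : {perm pm n}) :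
  reflect (signed w /\ ~~ signpar w) (w \in SD n).
Proof.
have -> : signpar w = odd #|Neg (pword w)|.
  rewrite -sum1_card (big_morph odd oddD (erefl (odd 0))) big_mkcond.
  apply: eq_bigr => i _; rewrite inE tnth_mktuple pmvalE.
  by case: (w _).2.
rewrite inE; apply: (iffP andP) => -[ws ->]; split=> //.
  by move=> a; apply/eqP; move/forallP: ws.
by apply/forallP=> a; rewrite ws.
Qed.

Lemma signpar_emb n (u : 'S_n) (w : {perm pm n}) :
  signpar (emb u * w) = signpar w.
Proof.
rewrite /signpar [RHS](reindex_inj (@perm_inj _ u)).
by apply: eq_bigr => i _; rewrite permM embE.
Qed.

Lemma SD_emb n (u : 'S_n) (w : {perm pm n}) :
  w \in SD n -> (emb u * w)%g \in SD n.
Proof.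
case/mem_SD=> ws we; apply/mem_SD; rewrite signpar_emb; split=> //.
by apply: signed_mul => //; apply: signed_emb.
Qed.

Lemma SD_sgen0 n (i j : 'I_n) (w : {perm pm n}) : i != j ->
  w \in SD n -> (sgen0 i j * w)%g \in SD n.
Proof.
move=> ij /mem_SD[ws we]; apply/mem_SD; split.
  by apply: signed_mul => //; apply: signed_sgen0.
suff -> : signpar (sgen0 i j * w) = signpar w by [].
have flip k (c : bool) : (w (k, c)).2 = (w (k, false)).2 (+) c.
  by case: c; rewrite ?addbF // signed_true //= addbT.
rewrite /signpar.
under eq_bigr => k _ do rewrite permM sgen0E // addFb flip.
pose F k := (w (k, false)).2.
rewrite big_split /=.
have /= <- := reindex_inj (P := xpredT) (F := F) (@perm_inj _ (tperm i j)).
rewrite [X in _ (+) X](bigD1 i) //=.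
rewrite [X in _ (+) (_ (+) X)](bigD1 j) 1?eq_sym //=.
rewrite !eqxx orbT [X in _ (+) (_ (+) (_ (+) X))]big1 ?addbF //.
by move=> k /andP[/negPf-> /negPf->].
Qed.

Lemma SD1 n : 1%g \in SD n.
Proof.
apply/mem_SD; split; first by move=> a; rewrite !perm1.
by rewrite /signpar big1 // => i _; rewrite perm1.
Qed.

Lemma lenD1 n : lenD (1%g : {perm pm n}) = 0.
Proof.
rewrite /lenD /wneg big_pred0 => [|i]; last by rewrite perm1.
rewrite addn0; apply: big1 => i _; apply: big1 => j _.
by rewrite /wval !perm1 pmval_lt /=; case: ltngtP.
Qed.

Lemma JP n (s : {perm pm n}) :
  reflect (exists i j : 'I_n, val j = (val i).+1 /\ s = emb (tperm i j))
          (s \in J n).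
Proof.
apply: (iffP imsetP) => [[u /imset2P[i j _]]|[i [j [ij ->]]]].
  by rewrite inE => /eqP ij -> ->; exists i, j.
exists (tperm i j) => //.
by apply/imset2P; exists i j; rewrite // inE; apply/eqP.
Qed.

Lemma S0P n (s : {perm pm n}) :
  reflect (exists i j : 'I_n, [/\ val i = 0, val j = 1 & s = sgen0 i j])
          (s \in S0 n).
Proof.
apply: (iffP imset2P) => [[i j _]|[i [j [i0 j1 ->]]]].
  by rewrite inE => /andP[_ /andP[/eqP i0 /eqP j1]] ->; exists i, j.
by exists i j; rewrite // inE /=; apply/andP; split; apply/eqP.
Qed.

(** Without descents every entry but possibly w(1) is positive, and then w(1) is
    positive as well because the number of negative entries is even. *)
Lemma SD_eq1 n (w : {perm pm n}) (i0 i1 : 'I_n) :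
    val i0 = 0 -> val i1 = 1 -> w \in SD n -> increasing w ->
    (0 < wval w i0 + wval w i1)%R ->
  w = 1%g.
Proof.
move=> v0 v1 /mem_SD[ws we] incr pos01.
have sgn i : (w (i, false)).2 = (wval w i < 0)%R.
  by rewrite /wval pmvalE; case: (w _).2.
have lt01 : (wval w i0 < wval w i1)%R.
  by rewrite incr; move: v0 v1 => /= -> ->.
have pos i : i != i0 -> (0 < wval w i)%R.
  move=> i_0; suff le1i : (wval w i1 <= wval w i)%R.
    move: lt01 le1i pos01.
    by move: (wval w i) (wval w i0) (wval w i1) => x y z; lia.
  rewrite leNgt incr -leqNgt; move: i_0; rewrite -val_eqE.
  by move: v0 v1 => /= -> ->; lia.
have pos0 : (0 < wval w i0)%R.
  have nz : wval w i0 != 0%R by rewrite /wval pmvalE; case: (w _).2.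
  move: we; rewrite /signpar (bigD1 i0) //= big1 => [|i /pos].
    by rewrite addbF sgn; lia.
  by rewrite sgn; lia.
have nneg i : (w (i, false)).2 = false.
  by rewrite sgn; have [->|/pos] := eqVneq i i0; lia.
have winj : injective (fun i => (w (i, false)).1).
  by move=> j k /eqP; rewrite signed_fst // => /eqP.
have u1 : perm winj = 1%g.
  apply: increasing_perm1 => i j.
  by rewrite !permE -[RHS]incr /wval pmval_lt !nneg.
have wf i : w (i, false) = (i, false).
  rewrite [LHS]surjective_pairing nneg; congr (_, _).
  by move/permP: u1 => /(_ i); rewrite permE perm1.
by apply/permP=> -[i []]; rewrite perm1 ?signed_true // wf.
Qed.

Lemma ellDE n (w : {perm pm n}) : 1 < n -> w \in SD n -> ellD w = lenD w.
Proof.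
move=> n1; pose i0 := Ordinal (ltnW n1); pose i1 := Ordinal n1.
have i01 (i j : 'I_n) : val i = 0 -> val j = 1 -> i != j.
  by rewrite -val_eqE /= => -> ->.
apply: wlen_eq; first exact: SD1.
- exact: lenD1.
- move=> s; rewrite inE => /orP[/S0P[i [j [vi vj ->]]]|/JP[i [j [ij ->]]]].
    by apply/permP=> a; rewrite permM perm1 sgen0K // i01.
  by apply/permP=> -[k c]; rewrite permM perm1 !embE tpermK.
- move=> s {}w; rewrite inE => /orP[/S0P[i [j [vi vj ->]]]|/JP[i [j [ij ->]]]].
    by apply: SD_sgen0; apply: i01.
  exact: SD_emb.
- move=> s {}w; rewrite inE.
  move=> /orP[/S0P[i [j [vi vj ->]]]|/JP[i [j [ij ->]]]] /mem_SD[ws _].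
    exact: eq_add_bool_le (lenD_S0 ws vi vj).
  exact: eq_add_bool_le (lenD_J ws ij).
move=> {}w wSD w1; case/mem_SD: (wSD) => ws _.
have [neg01|pos01] := boolP (wval w i0 + wval w i1 < 0)%R.
  exists (sgen0 i0 i1).
    by rewrite inE; apply/orP; left; apply/S0P; exists i0, i1.
  by apply: eq_add_bool_lt (lenD_S0 ws _ _) _ _ => //; rewrite -leNgt ltW.
have [[i [j [ij lt]]]|incr] := descent_or_increasing (@wval_inj _ w).
  exists (emb (tperm i j)).
    by rewrite inE; apply/orP; right; apply/JP; exists i, j.
  by apply: (eq_add_bool_lt (lenD_J ws ij) lt); rewrite -leNgt ltW.
case/eqP: w1; apply: (@SD_eq1 _ _ i0 i1) => //.
(* w(1) + w(2) is not 0: otherwise w would send 2 and -1 to the same point. *)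
rewrite lt_neqAle leNgt pos01 andbT eq_sym addrC addr_eq0 -pmval_opp.
by rewrite (inj_eq (@pmval_inj n)) -signed_true // (inj_eq perm_inj).
Qed.

(** * The parabolic factorization *)

Lemma minrepJP n (w : {perm pm n}) : 1 < n ->
  reflect (w \in SD n /\ increasing w) (w \in minrepJ n).
Proof.
move=> n1; rewrite [w \in minrepJ n]inE.
apply: (iffP andP) => -[wSD wJ]; split=> //;
  case/mem_SD: (wSD) => ws _.
  have [[i [j [ij lt]]]|//] := descent_or_increasing (@wval_inj _ w).
  have := forallP wJ (emb (tperm i j)).
  rewrite (introT (JP _)) /=; last by exists i, j.
  rewrite /fcomp !ellDE ?SD_emb // ltnNge => /negP[].
  by apply/ltnW/(eq_add_bool_lt (lenD_J ws ij) lt); rewrite -leNgt ltW.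
apply/forallP=> s; apply/implyP=> /JP[i [j [ij ->]]].
rewrite /fcomp !ellDE ?SD_emb //; apply: (eq_add_bool_lt (esym (lenD_J ws ij))).
  by rewrite wJ /= ij.
by rewrite wJ -leqNgt /= ij.
Qed.

Lemma wval_emb n (u : 'S_n) (w : {perm pm n}) i :
  wval (emb u * w) i = wval w (u i).
Proof. by rewrite /wval permM embE. Qed.

Lemma wneg_emb n (u : 'S_n) (w : {perm pm n}) : wneg (emb u * w) = wneg w.
Proof.
rewrite /wneg [RHS](reindex_inj (@perm_inj _ u)).
by apply: eq_big => [i|i _]; rewrite permM embE.
Qed.

(** The inversions of p u are those of u because p is increasing, and N does
    not see the permutation u of the positions. *)
Lemma lenD_emb_increasing n (u : 'S_n) (p : {perm pm n}) : increasing p ->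
  lenD (emb u * p) = ell u + wneg p.
Proof.
move=> pincr; rewrite /lenD wneg_emb ellE; congr (_ + _).
rewrite /invs big_mkcond /winv pair_bigA; apply: eq_bigr => -[i j] _ /=.
by rewrite !wval_emb pincr /ltI; case: (i < j).
Qed.

Lemma emb1 n : emb (1%g : 'S_n) = 1%g.
Proof. by apply/permP=> -[i c]; rewrite embE !perm1. Qed.

Lemma ell1 n : ell (1%g : 'S_n) = 0.
Proof.
rewrite ellE /invs big1 // => -[i j].
by rewrite /ltI /= !perm1; case: ltngtP.
Qed.

Lemma increasing1 n : increasing (1%g : {perm pm n}).
Proof. by move=> i j; rewrite /wval !perm1 pmval_lt. Qed.

(** Since q is increasing, v i is the rank of the i-th entry of the word of q v;
    so the word determines v, and then q. *)
Lemma factorJ_eq n (u : 'S_n) (p : {perm pm n}) :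
    1 < n -> p \in SD n -> increasing p ->
  factorJ (fcomp p (emb u)) = (p, u).
Proof.
move=> n1 pSD pincr; rewrite /factorJ; case: pickP => [[q v]|/(_ (p, u))].
  case/and3P=> /= /(minrepJP _ n1)[qSD qincr] /eqP e _.
  have uv : u = v.
    apply/permP=> i; apply: val_inj.
    rewrite (@perm_rank _ u (wval (emb u * p))); last first.
      by move=> j k; rewrite !wval_emb pincr.
    rewrite (@perm_rank _ v (wval (emb u * p))) // => j k.
    by rewrite [(emb u * p)%g]e !wval_emb qincr.
  by move: e; rewrite /fcomp uv => /mulgI->.
have len v : ellD (emb v * p) = ell v + wneg p.
  by rewrite ellDE ?SD_emb // lenD_emb_increasing.
have lenv : ellD (emb u) = ell u.
  rewrite -[emb u]mulg1 ellDE ?SD_emb ?SD1 //.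
  rewrite lenD_emb_increasing; last exact: increasing1.
  by rewrite /wneg big_pred0 ?addn0 // => i; rewrite perm1.
rewrite /factJ /= /fcomp eqxx len lenv -[p in ellD p]mul1g -emb1 len ell1.
by rewrite add0n addnC eqxx (introT (minrepJP _ n1)).
Qed.

Lemma SD_factor n (w : {perm pm n}) : w \in SD n ->
  exists u p, [/\ p \in SD n, increasing p & w = fcomp p (emb u)].
Proof.
move=> wSD; have [u uP] := rank_exists (@wval_inj _ w).
exists u, (emb u^-1 * w)%g; split; first exact: SD_emb.
  by move=> i j; rewrite !wval_emb -uP !permKV.
by apply/permP=> -[i c]; rewrite !permM !embE permK.
Qed.

(** * The negative major index *)

Lemma maj_standardization n (u : 'S_n) (w : {perm pm n}) :
    (forall i j, (wval w i < wval w j)%R = (u i < u j)) ->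
  maj (pword w) = maj (sword u).
Proof.
move=> wu; rewrite /maj big_nat_cond [RHS]big_nat_cond; apply: eq_bigl => i.
apply: andb_id2l => /andP[i1 ltin].
have ltin' : i.-1 < n by apply: leq_ltn_trans ltin; apply: leq_pred.
have := wu (Ordinal ltin) (Ordinal ltin').
rewrite -[i]/(val (Ordinal ltin)).
rewrite -[(val (Ordinal ltin)).-1]/(val (Ordinal ltin')).
by rewrite !nth_mktuple ltz_nat ltnS => <-.
Qed.

Lemma dmajE n (w : {perm pm n}) :
  dmaj (pword w) = Posz (maj (pword w) + wneg w).
Proof.
rewrite /dmaj /wneg PoszD -addrA; congr (_ + _)%R.
rewrite -sum1_card !(big_morph Posz PoszD (erefl _)) -!sumrN -big_split /=.
apply: eq_big => [i|i].
  by rewrite inE tnth_mktuple pmvalE; case: (w _).2.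
by rewrite inE tnth_mktuple pmvalE; case: (w _).2 => //= _; lia.
Qed.

Theorem corollary6p2 (n : nat) (hn : (4 <= n)%N)
    (iota : 'S_n -> 'S_n) (iota_invol : involutive iota)
    (maj_iota : forall u : 'S_n, maj (sword u) = ell (iota u)) :
  exists iotaD : SDtype n -> SDtype n,
    [/\ involutive iotaD,
        forall w : SDtype n,
          dmaj (pword (val w)) = Posz (ellD (val (iotaD w)))
      & forall w : SDtype n,
          val (iotaD w) = fcomp (PJ (val w)) (emb (iota (partJ (val w))))].
Proof.
have n1 : 1 < n by apply: leq_trans hn.
pose f (w : {perm pm n}) := fcomp (PJ w) (emb (iota (partJ w))).
have fE p u : p \in SD n -> increasing p ->
    f (fcomp p (emb u)) = fcomp p (emb (iota u)).
  by move=> pSD pincr; rewrite /f /PJ /partJ factorJ_eq.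
have fSD w : w \in SD n -> f w \in SD n.
  by case/SD_factor=> u [p [pSD pincr ->]]; rewrite fE //; apply: SD_emb.
exists (fun w => exist (fun v => v \in SD n) (f (val w)) (fSD _ (valP w))).
split=> // -[w wSD]; have [u [p [pSD pincr wE]]] := SD_factor wSD.
  by apply: val_inj; rewrite /= wE !fE // iota_invol.
rewrite /= wE fE // ellDE ?SD_emb // lenD_emb_increasing // -maj_iota.
rewrite dmajE wneg_emb (@maj_standardization _ u) // => i j.
by rewrite !wval_emb pincr.
Qed.
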